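(* Let $(G,G^+)$ be a simple partially ordered abelian group of rank one, and let $\mathfrak{n}$ be a generalized integer associated to $G$ (i.e. $G\cong\mathbb{Z}_{\mathfrak{n}}$ as abelian groups). Then for every infinite generalized integer $\mathfrak{m}$ coprime with $\mathfrak{n}$ there exist a simple Riesz group of rank one $(\widetilde G(\mathfrak{m}),\widetilde G^+(\mathfrak{m}))$ and a positive morphism $\tau\colon G\to\widetilde G(\mathfrak{m})$ such that (1) $\widetilde G(\mathfrak{m})$ is isomorphic, as an abelian group, to $\mathbb{Z}_{\mathfrak{n}\cdot\mathfrak{m}}$, and (2) $\tau$ is an order-embedding.
   Context: Partially ordered abelian group $(G,G^+)$: abelian group with a submonoid $G^+\ni 0$ with $G^+\cap(-G^+)=\{0\}$, $x\le_G y$ iff $y-x\in G^+$. It is simple if $G\ne 0$ and every nonzero $u\in G^+$ is an order-unit (for all $x$ there is $n$ with $-nu\le x\le nu$). It is a Riesz group if whenever $x,y_1,y_2\in G^+$ with $x\le y_1+y_2$ there are $x_1,x_2\in G^+$ with $x=x_1+x_2$, $x_j\le y_j$. Rank one: isomorphic to a nonzero subgroup of $\mathbb{Q}$. A positive morphism is a homomorphism $f$ with $f(G^+)\subseteq H^+$; an order-embedding is an injective positive morphism with $f(G^+)=f(G)\cap H^+$. A generalized integer is a map $\mathfrak{n}\colon\mathbb{P}\to\{0,1,2,\dots,\infty\}$ ($\mathbb{P}$ the primes), written $\prod_p p^{\mathfrak{n}(p)}$; it is finite if it never takes the value $\infty$ and is nonzero at only finitely many primes, and infinite otherwise. Products add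 exponents; $\mathfrak{n}\mid\mathfrak{m}$ if $\mathfrak{m}=\mathfrak{n}\mathfrak{n}'$ for some $\mathfrak{n}'$; $\mathfrak{n},\mathfrak{m}$ are coprime if for every prime $p$, $0\in\{\mathfrak{n}(p),\mathfrak{m}(p)\}$. $\mathbb{Z}_{\mathfrak{n}}=\{a/b\in\mathbb{Q}: a\in\mathbb{Z}, b\mid\mathfrak{n}\}$; every subgroup of $\mathbb{Q}$ containing $1$ is $\mathbb{Z}_{\mathfrak{n}}$ for a unique $\mathfrak{n}$. *)

(* Defs.v *)
From mathcomp Require Import all_boot all_order all_algebra.
Set Implicit Arguments. Unset Strict Implicit. Unset Printing Implicit Defensive.
Import GRing.Theory Num.Theory.
Local Open Scope ring_scope.

Definition pogroup (G : zmodType) (P : G -> Prop) : Prop :=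
  [/\ P 0, (forall x y, P x -> P y -> P (x + y))
    & (forall x, P x -> P (- x) -> x = 0)].

Definition pole (G : zmodType) (P : G -> Prop) (x y : G) : Prop := P (y - x).

Definition order_unit (G : zmodType) (P : G -> Prop) (u : G) : Prop :=
  forall x : G, exists n : nat, pole P (- (u *+ n)) x /\ pole P x (u *+ n).

Definition simple_po (G : zmodType) (P : G -> Prop) : Prop :=
  (exists x : G, x <> 0) /\ (forall u : G, P u -> u <> 0 -> order_unit P u).

Definition riesz (G : zmodType) (P : G -> Prop) : Prop :=
  forall x y1 y2 : G, P x -> P y1 -> P y2 -> pole P x (y1 + y2) ->
    exists x1 x2 : G, [/\ P x1, P x2, x = x1 + x2, pole P x1 y1 & pole P x2 y2].

Definition additive_map (G H : zmodType) (f : G -> H) : Prop :=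
  forall x y, f (x + y) = f x + f y.

Definition rank_one (G : zmodType) : Prop :=
  (exists x : G, x <> 0) /\
  exists f : G -> rat, additive_map f /\ injective f.

Definition positive_morphism (G H : zmodType) (P : G -> Prop) (Q : H -> Prop)
  (f : G -> H) : Prop :=
  additive_map f /\ (forall x, P x -> Q (f x)).

Definition order_embedding (G H : zmodType) (P : G -> Prop) (Q : H -> Prop)
  (f : G -> H) : Prop :=
  [/\ positive_morphism P Q f, injective f &
      forall y : H, (exists x, P x /\ f x = y) <-> ((exists x, f x = y) /\ Q y)].

(* A generalized integer: exponent at each prime p, None meaning infinity.
   Only the values at primes are meaningful. *)
Definition gint := nat -> option nat.

Definition gmul (n m : gint) : gint := fun p =>
  match n p, m p with
  | Some a, Some b => Some (a + b)%N
  | _, _ => None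
  end.

Definition gint_finite (n : gint) : Prop :=
  (forall p, prime p -> n p <> None) /\
  exists N : nat, forall p, prime p -> (N < p)%N -> n p = Some 0%N.

Definition gint_infinite (n : gint) : Prop := ~ gint_finite n.

Definition gdvd (n m : gint) : Prop :=
  exists n' : gint, forall p, prime p -> m p = gmul n n' p.

Definition gcoprime (n m : gint) : Prop :=
  forall p, prime p -> n p = Some 0%N \/ m p = Some 0%N.

Definition gint_of_nat (b : nat) : gint := fun p => Some (logn p b).

Definition inZg (n : gint) (q : rat) : Prop :=
  exists (a : int) (b : nat),
    [/\ (0 < b)%N, gdvd (gint_of_nat b) n & q = a%:~R / b%:R].

Definition iso_Zg (G : zmodType) (n : gint) : Prop :=
  exists f : G -> rat,
    [/\ additive_map f, injective f & forall q, inZg n q <-> exists x, f x = q].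

(* Main.v *)
From HB Require Import structures.
Require Import Defs.
From mathcomp Require Import all_boot all_order all_algebra.
From mathcomp Require Import boolp zify ring lra.
Set Implicit Arguments. Unset Strict Implicit. Unset Printing Implicit Defensive.
Import Order.TTheory GRing.Theory Num.Theory.
Local Open Scope ring_scope.

(** View [G] as [Z_n] inside [rat], with positive cone in the nonnegative
    rationals, and let [D_N] be the lcm of the divisors of [m] up to [N].
    Coprimality gives [Z_(n m)] as the increasing union of the layers
    [D_N^-1 Z_n].  Given [x <= y1 + y2] in the cone of one layer, choose a later
    layer, of index [d] over it, and a rational [c] generating the quotient
    with [max(0, x - y2) < c < min(x, y1)], and adjoin [c], [x - c], [y1 - c]
    and [y2 - x + c] to the cone.  A sum of these returning to the old layer is a
    sum of old positive elements and of at least [d] terms bounded below; since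
    [m] is infinite, [d] can be taken so large that the order-unit property puts
    such sums in the old cone already.  So the old cone is unchanged, one
    instance of the Riesz property has been solved, and countably many such
    steps solve them all. *)

(** * Divisors of generalized integers and the denominators of the layers *)

Lemma gdvd_natP (b : nat) (m : gint) :
  gdvd (gint_of_nat b) m <->
  forall p e, prime p -> m p = Some e -> (logn p b <= e)%N.
Proof.
split=> [[n' hn'] p e pp mp|h].
  have := hn' p pp; rewrite mp /gmul /gint_of_nat.
  by case: (n' p) => // k [->]; rewrite leq_addr.
exists (fun p => if m p is Some e then Some (e - logn p b)%N else None) => p pp.
rewrite /gmul /gint_of_nat; case E: (m p) => [e|] //.
by rewrite subnKC // (h _ _ pp E).
Qed.

Lemma gdvd_dvdn (a b : nat) (m : gint) : (0 < b)%N -> (a %| b)%N ->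
  gdvd (gint_of_nat b) m -> gdvd (gint_of_nat a) m.
Proof.
move=> b0 ab /gdvd_natP h; apply/gdvd_natP => p e pp /(h p e pp).
exact/leq_trans/dvdn_leq_log.
Qed.

Lemma gdvd_lcmn (a b : nat) (m : gint) : (0 < a)%N -> (0 < b)%N ->
  gdvd (gint_of_nat a) m -> gdvd (gint_of_nat b) m ->
  gdvd (gint_of_nat (lcmn a b)) m.
Proof.
move=> a0 b0 /gdvd_natP ha /gdvd_natP hb; apply/gdvd_natP => p e pp mp.
by rewrite logn_lcm // geq_max (ha p e) // (hb p e).
Qed.

Lemma gdvd_1 (m : gint) : gdvd (gint_of_nat 1) m.
Proof. by apply/gdvd_natP => p e _ _; rewrite logn1. Qed.

Lemma gcoprime_coprime (n m : gint) (a b : nat) : gcoprime n m ->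
  (0 < a)%N -> (0 < b)%N ->
  gdvd (gint_of_nat a) n -> gdvd (gint_of_nat b) m -> coprime a b.
Proof.
move=> nm a0 b0 /gdvd_natP ha /gdvd_natP hb; rewrite coprime_has_primes //.
apply/hasPn => p; rewrite !mem_primes => /and3P[pp _ pb].
rewrite pp a0 /=; apply/negP => pa.
case: (nm p pp) => [/(ha _ _ pp)|/(hb _ _ pp)].
  by rewrite leqNgt logn_gt0 mem_primes pp a0 pa.
by rewrite leqNgt logn_gt0 mem_primes pp b0 pb.
Qed.

(** Either some prime has infinite exponent in [m], and all its powers are available, or infinitely
    many primes divide [m]; a prime beyond both [B] and [D] then works with exponent one, as it
    cannot divide [D]. *)
Lemma gint_infinite_pow (m : gint) (D B : nat) : gint_infinite m ->
  (0 < D)%N -> gdvd (gint_of_nat D) m ->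
  exists q e, [/\ prime q, (B <= q ^ e)%N & gdvd (gint_of_nat (D * q ^ e)%N) m].
Proof.
move=> infm D0 /gdvd_natP Dm.
case: (pselect (exists2 q, prime q & m q = None)) => [[q pq mq]|nex].
  exists q, B; split=> //; first by rewrite ltnW // ltn_expl // prime_gt1.
  have q0 := prime_gt0 pq; apply/gdvd_natP => p e pp mp; rewrite lognM ?expn_gt0 ?q0 // lognX.
  rewrite (logn_prime p pq); case: eqVneq => [qp|_]; first by rewrite qp mq in mp.
  by rewrite muln0 addn0 (Dm p e).
have [q [pq ltq mq]] :
    exists q, [/\ prime q, (maxn B D < q)%N & m q <> Some 0%N].
  apply: contrapT => nq; apply: infm; split=> [p pp mp|]; first by apply: nex; exists p.
  exists (maxn B D) => p pp lp; apply: contrapT => mp; apply: nq; by exists p.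
move: ltq; rewrite gtn_max => /andP[Bq Dq].
exists q, 1%N; rewrite expn1; split=> //; first exact: ltnW.
apply/gdvd_natP => p e pp mp; rewrite lognM ?(prime_gt0 pq) //.
rewrite (logn_prime p pq); case: eqVneq => [qp|_]; last by rewrite addn0 (Dm p e).
suff -> : logn p D = 0%N by move: mq; rewrite -qp mp; case: (e).
by apply/eqP; rewrite -leqn0 leqNgt logn_gt0 qp mem_primes; apply/negP => /and3P[_ _ /dvdn_leq]; lia.
Qed.

(** The values form a divisibility chain, and every divisor of [m] divides some value. *)
Definition lcm_upto (m : gint) (N : nat) : nat :=
  \big[lcmn/1%N]_(b < N.+1 | (0 < b)%N && `[< gdvd (gint_of_nat b) m >]) b.

Lemma lcm_upto_gdvd m N : (0 < lcm_upto m N)%N /\ gdvd (gint_of_nat (lcm_upto m N)) m.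
Proof.
rewrite /lcm_upto; elim/big_ind: _ => [|a b [a0 ha] [b0 hb]|b /andP[b0 /asboolP hb]] //.
- by split=> //; exact: gdvd_1.
- by split; [rewrite lcmn_gt0 a0|exact: gdvd_lcmn].
Qed.

Lemma dvdn_lcm_upto m N b : (0 < b)%N -> (b <= N)%N ->
  gdvd (gint_of_nat b) m -> (b %| lcm_upto m N)%N.
Proof.
move=> b0 bN hb.
by rewrite /lcm_upto (biglcmn_sup (Ordinal (bN : (b < N.+1)%N))) //= b0; apply/asboolP.
Qed.

Lemma lcm_upto_dvdn m N N' : (N <= N')%N -> (lcm_upto m N %| lcm_upto m N')%N.
Proof.
move=> NN'; rewrite {1}/lcm_upto; apply/dvdn_biglcmP => b /andP[b0 /asboolP hb].
by apply: dvdn_lcm_upto => //; have := ltn_ord b; lia.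
Qed.

Lemma lcm_upto0 m : lcm_upto m 0 = 1%N.
Proof. by rewrite /lcm_upto big1 // => -[[|b] hb] //= /andP[]. Qed.

(** The index of the later layer is split as [d1 * q ^ e] because a coprime numerator will be sought
    in a window of length [3 * d1]: a large [q ^ e] makes this window short relative to the
    index. *)
Lemma lcm_upto_jump (m : gint) (N B : nat) : gint_infinite m ->
  exists N' d1 q e, [/\ (N < N')%N, lcm_upto m N' = (lcm_upto m N * (d1 * q ^ e)%N)%N,
    prime q, ~~ (q %| d1)%N & (B <= q ^ e)%N].
Proof.
move=> infm; have [D0 Dm] := lcm_upto_gdvd m N.
have [q [e [pq Be De]]] := gint_infinite_pow B infm D0 Dm.
set D := lcm_upto m N in D0 Dm De *.
have q0 := prime_gt0 pq.
pose N' := (N + (D * q ^ e)%N).+1; exists N'.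
have [D'0 _] := lcm_upto_gdvd m N'.
have : ((D * q ^ e)%N %| lcm_upto m N')%N.
  by apply: dvdn_lcm_upto => //; rewrite ?muln_gt0 ?D0 ?expn_gt0 ?q0 // /N'; lia.
move=> /dvdnP[k E]; rewrite E in D'0 *.
have k0 : (0 < k)%N by case: (k) D'0.
(* The [q]-part of the cofactor [k] is moved into the prime power, which can only enlarge it. *)
exists (k`_(q^'))%N, q, (logn q k + e)%N; split=> //.
- by rewrite /N'; lia.
- by rewrite -{1}(partnC q k0) p_part expnD; ring.
- have := part_pnat q^' k; rewrite p'natE //.
- apply: leq_trans Be _; rewrite leq_pexp2l //; lia.
Qed.

(** The numbers [1 + j * d1] are coprime to [d1], and [q] cannot divide two consecutive ones, since
    it would divide their difference [d1]. The two candidates use the first two [j] with [j * d1]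
    beyond [lo]. *)
Lemma coprime_in_interval (lo : rat) (d1 q e : nat) :
  0 <= lo -> (0 < d1)%N -> prime q -> ~~ (q %| d1)%N ->
  exists t : nat, [/\ coprime t (d1 * q ^ e)%N, lo < t%:R & t%:R <= lo + 3 * d1%:R].
Proof.
move=> lo0 d10 pq qd1.
have d1p : 0 < d1%:R :> rat by rewrite ltr0n.
have /Num.Theory.truncn_itv/andP[ha hb] : 0 <= lo / d1%:R by rewrite divr_ge0 // ltW.
set k := Num.truncn (lo / d1%:R) in ha hb.
rewrite ler_pdivlMr // in ha; rewrite ltr_pdivrMr // in hb.
have d11 : 1 <= d1%:R :> rat by rewrite ler1n.
rewrite -natr1 in hb.
pose A := (1 + k.+1 * d1)%N.
have cop j : coprime (1 + j * d1)%N d1 by rewrite /coprime gcdnC addnC gcdnMDl gcdn1.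
have copq j : ~~ (q %| 1 + j * d1)%N -> coprime (1 + j * d1)%N (d1 * q ^ e)%N.
  by move=> hq; rewrite coprimeMr cop coprimeXr // coprime_sym prime_coprime.
have [hq|/negPn hq] := boolP (~~ (q %| 1 + k.+1 * d1)%N).
  exists (1 + k.+1 * d1)%N; split; first exact: copq.
    rewrite natrD natrM -natr1; lra.
  rewrite natrD natrM -natr1; lra.
exists (1 + k.+2 * d1)%N; split.
- apply: copq; apply/negP => hq'; move/negP: qd1; apply.
  have -> : d1 = ((1 + k.+2 * d1) - (1 + k.+1 * d1))%N by lia.
  exact: dvdn_sub.
- rewrite natrD natrM -!natr1; lra.
- rewrite natrD natrM -!natr1; lra.
Qed.

(** * Arithmetic of the groups [Z_n] inside the rationals *)

Lemma inZg_common n (x y : rat) : inZg n x -> inZg n y ->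
  exists (a a' : int) (b : nat),
    [/\ (0 < b)%N, gdvd (gint_of_nat b) n, x = a%:~R / b%:R & y = a'%:~R / b%:R].
Proof.
move=> [a [b [b0 hb ->]]] [a' [b' [b'0 hb' ->]]].
have l0 : (0 < lcmn b b')%N by rewrite lcmn_gt0 b0.
have key (c : int) k : (0 < k)%N -> (k %| lcmn b b')%N ->
    c%:~R / k%:R = (c * (lcmn b b' %/ k)%N)%:~R / (lcmn b b')%:R :> rat.
  move=> k0 /dvdnP[j E]; rewrite E mulnK // natrM intrM /= -pmulrn.
  have j0 : (j != 0)%N by apply/eqP => j0; rewrite E j0 in l0.
  by field; rewrite !pnatr_eq0 j0 -lt0n k0.
exists (a * (lcmn b b' %/ b)%N), (a' * (lcmn b b' %/ b')%N), (lcmn b b').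
split=> //; [exact: gdvd_lcmn|exact/key/dvdn_lcml|exact/key/dvdn_lcmr].
Qed.

Lemma inZg_int n (a : int) : inZg n a%:~R.
Proof. by exists a, 1%N; split=> //; [exact: gdvd_1|rewrite divr1]. Qed.

Lemma inZg_lin n x y (i j : int) : inZg n x -> inZg n y ->
  inZg n (i%:~R * x + j%:~R * y).
Proof.
move=> hx hy; have [a [a' [b [b0 hb -> ->]]]] := inZg_common hx hy.
exists (i * a + j * a'), b; split=> //; rewrite intrD !intrM.
by field; rewrite pnatr_eq0 -lt0n.
Qed.

Lemma inZgD n x y : inZg n x -> inZg n y -> inZg n (x + y).
Proof. by move=> hx /(inZg_lin 1 1 hx); rewrite !mul1r. Qed.

Lemma inZgB n x y : inZg n x -> inZg n y -> inZg n (x - y).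
Proof. by move=> hx /(inZg_lin 1 (-1) hx); rewrite mul1r intrN mulN1r. Qed.

Lemma inZgZ n x (i : int) : inZg n x -> inZg n (i%:~R * x).
Proof. by move=> hx; have := inZg_lin i 0 hx hx; rewrite mul0r addr0. Qed.

Lemma inZgMn n x (i : nat) : inZg n x -> inZg n (x *+ i).
Proof. by move=> /(inZgZ i); rewrite -pmulrn mulr_natl. Qed.

(** Denominators dividing [n] are coprime to [d], so [d] has to cancel against the numerator. *)
Lemma inZg_frac n m (s : int) (d : nat) : gcoprime n m -> (0 < d)%N ->
  gdvd (gint_of_nat d) m -> inZg n (s%:~R / d%:R) -> (d%:Z %| s)%Z.
Proof.
move=> nm d0 dm [a [b [b0 bn E]]].
have cop := gcoprime_coprime nm b0 d0 bn dm.
have : (s * b)%:~R = (a * d)%:~R :> rat.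
  rewrite !intrM -!pmulrn; have b0' : b%:R != 0 :> rat by rewrite pnatr_eq0 -lt0n.
  have d0' : d%:R != 0 :> rat by rewrite pnatr_eq0 -lt0n.
  apply: (mulIf (x := d%:R^-1 * b%:R^-1)); first by rewrite mulf_neq0 ?invr_eq0.
  by rewrite mulrACA divff // mulr1 E; field; rewrite b0'.
move=> /intr_inj E'.
have : (d%:Z %| s * b)%Z by rewrite E' dvdz_mull.
by rewrite Gauss_dvdzl // coprimezE /= coprime_sym.
Qed.

Lemma logn_partN (pi : nat_pred) p b : p \notin pi -> logn p (b`_pi)%N = 0%N.
Proof.
move=> hp; apply/eqP; rewrite -leqn0 leqNgt logn_gt0; apply: contra hp.
exact/pnatPpi/part_pnat.
Qed.

Lemma leq_logn_part (pi : nat_pred) p b : (0 < b)%N -> (logn p (b`_pi)%N <= logn p b)%N.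
Proof. by move=> b0; apply: dvdn_leq_log => //; exact: dvdn_part. Qed.

(** A denominator is split along the primes with nonzero exponent in [m]: that part divides [m],
    since [n] vanishes there, and the complementary part divides [n]. *)
Lemma inZg_gmul n m x : gcoprime n m ->
  inZg (gmul n m) x <-> exists N, inZg n ((lcm_upto m N)%:R * x).
Proof.
move=> nm; split=> [[a [b [b0 /gdvd_natP hb ->]]]|[N [a [b [b0 /gdvd_natP hb E]]]]].
  pose pi : nat_pred := [pred p | m p != Some 0%N].
  have hpi : gdvd (gint_of_nat (b`_pi)%N) m.
    apply/gdvd_natP => p e pp mp; case: e mp => [|e] mp.
      by rewrite logn_partN // inE mp eqxx.
    apply: leq_trans (leq_logn_part _ _ b0) _; apply: hb => //.
    by case: (nm p pp); rewrite /gmul mp // => ->.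
  have hpi' : gdvd (gint_of_nat (b`_pi^')%N) n.
    apply/gdvd_natP => p e pp np; have [hp|hp] := boolP (p \in pi).
      by rewrite logn_partN // inE /= negbK.
    apply: leq_trans (leq_logn_part _ _ b0) _; apply: hb => //.
    by move: hp; rewrite inE negbK /gmul => /eqP ->; rewrite np addn0.
  exists b; have /dvdnP[k ->] := dvdn_lcm_upto (part_gt0 pi b) (dvdn_leq b0 (dvdn_part _ _)) hpi.
  exists (a * k), (b`_pi^')%N; split=> //.
  rewrite -{2}(partnC pi b0) !natrM intrM -pmulrn; field.
  by rewrite !pnatr_eq0 -!lt0n !part_gt0.
have [D0 /gdvd_natP Dm] := lcm_upto_gdvd m N.
exists a, (lcm_upto m N * b)%N; split; first by rewrite muln_gt0 D0.
  apply/gdvd_natP => p e pp; rewrite /gmul lognM //.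
  case En: (n p) => [f|//]; case Em: (m p) => [g|//] [<-].
  by rewrite addnC leq_add // ?(hb p) ?(Dm p).
rewrite natrM invfM mulrCA -E; field.
by rewrite pnatr_eq0 -lt0n.
Qed.

(** * Cones on a single layer and their extension to a later one *)

(** A positive cone on the layer [D^-1 Z_n] with order-unit [u]. Absorption is one-sided, as its use
    at [- x] gives the other bound. *)
Definition cone (n : gint) (D : nat) (u : rat) (Q : rat -> Prop) : Prop :=
  [/\ Q 0, forall x y, Q x -> Q y -> Q (x + y),
      forall x, Q x -> 0 <= x /\ inZg n (D%:R * x),
      0 < u /\ Q u
    & forall x, inZg n (D%:R * x) -> exists k, Q (x + u *+ k)].

Lemma coneMn n D u Q x k : cone n D u Q -> Q x -> Q (x *+ k).
Proof.
by move=> [Q0 QD _ _ _] Qx; elim: k => [|k IH]; rewrite ?mulr0n // mulrS; exact: QD.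
Qed.

Lemma pos_commensurable (x y : rat) : 0 < x -> 0 < y ->
  exists a b : nat, [/\ (0 < a)%N, (0 < b)%N & x *+ a = y *+ b].
Proof.
move=> x0 y0; have q0 : 0 < x / y by rewrite divr_gt0.
have nq : 0 < numq (x / y) by rewrite numq_gt0.
exists `|denq (x / y)|%N, `|numq (x / y)|%N.
split; [by rewrite absz_gt0 denq_neq0|by rewrite absz_gt0 gt_eqF|].
have yn : y != 0 by rewrite gt_eqF.
rewrite -[x *+ _]mulr_natr -[y *+ _]mulr_natr !natr_absz (gtr0_norm nq) (gtr0_norm (denq_gt0 _)).
by rewrite numqE mulrA mulrCA divff // mulr1.
Qed.

(* Only finitely many classes of [g *~ z] modulo a common multiple of [g] and
   [u] occur, so finitely many applications of the order-unit axiom suffice. *)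
Lemma cone_large n D u Q g : cone n D u Q -> 0 < g -> inZg n (D%:R * g) ->
  exists B : rat, forall z : int, B <= g *~ z -> Q (g *~ z).
Proof.
move=> cQ g0 hg; have [Q0 QD Qp [u0 Qu] Qk] := cQ.
have [a [b [a0 b0 ab]]] := pos_commensurable g0 u0.
have /choice[k hk] : forall r : nat, exists k, Q (g *+ r + u *+ k).
  by move=> r; apply: Qk; rewrite mulrnAr; exact: inZgMn.
(* A common bound for the finitely many [k r] with [r < a]. *)
pose K := (\sum_(r < a) k r)%N.
exists (g *~ (a * K.+1)%N) => z; rewrite ler_pMz2l // => hz.
have -> : z = `|z|%N by lia.
set m := `|z|%N; have hm : (a * K.+1 <= m)%N by lia.
have mE := divn_eq m a; have rlt : (m %% a < a)%N by rewrite ltn_mod.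
set j := (m %/ a)%N in mE; set r := (m %% a)%N in mE rlt.
have kr : (k r <= K)%N by rewrite /K (bigD1 (Ordinal rlt)) //= leq_addr.
have Kj : (K <= j)%N by rewrite leq_divRL //; lia.
have krj : (k r <= b * j)%N by nia.
have -> : g *~ m = (g *+ r + u *+ k r) + u *+ (b * j - k r).
  rewrite -addrA -mulrnDr subnKC // -pmulrn {1}mE addnC mulrnDr mulnC !mulrnA.
  by rewrite ab.
by apply: QD => //; exact: coneMn cQ _.
Qed.

(** Finitely many elements share a denominator [D * b] with [b] dividing [n], and its inverse serves
    as [g]. This reduces membership of large elements to [cone_large]. *)
Lemma cyclic_lattice n D (s : seq rat) : (0 < D)%N ->
  (forall x, x \in s -> inZg n (D%:R * x)) ->
  exists g, [/\ 0 < g, inZg n (D%:R * g)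
              & forall x, x \in s -> exists z : int, x = g *~ z].
Proof.
move=> D0; have D0' : D%:R != 0 :> rat by rewrite pnatr_eq0 -lt0n.
elim: s => [_|x s IH hs].
  exists D%:R^-1; split=> //; first by rewrite invr_gt0 ltr0n.
  by rewrite divff //; exact: inZg_int 1.
have [y ys|g [g0 hg gs]] := IH.
  by apply: hs; rewrite in_cons ys orbT.
have [a [a' [b [b0 hb Ex Eg]]]] := inZg_common (hs x (mem_head _ _)) hg.
have b0' : b%:R != 0 :> rat by rewrite pnatr_eq0 -lt0n.
have div (y : rat) (c : int) : D%:R * y = c%:~R / b%:R -> y = (D%:R * b%:R)^-1 *~ c.
  move=> E; apply: (mulfI D0'); rewrite E -mulrzr; field.
  by rewrite b0' D0'.
exists (D%:R * b%:R)^-1; split.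
- by rewrite invr_gt0 mulr_gt0 ?ltr0n.
- exists 1, b; split=> //; rewrite mul1r; field; by rewrite b0' D0'.
- move=> y; rewrite in_cons => /predU1P[->|/gs[z ->]]; first by exists a; exact: div.
  by exists (a' * z); rewrite mulrzA; congr (_ *~ _); exact: div.
Qed.

(* The mixed sums [c + (x - c)], [c + (y1 - c)], ... already lie in [Q], so a
   combination of the four new generators that falls back into the small layer
   reduces to one using only [c] and [y2 - x + c], or only [x - c] and [y1 - c];
   the number of terms is then a multiple of [d], hence the sum is large. *)
Lemma adjoin_riesz n D d u Q (x y1 y2 c g B eps : rat) :
  cone n D u Q -> Q x -> Q y1 -> Q y2 -> Q (y1 + y2 - x) ->
  inZg n ((D * d)%:R * c) ->
  (forall s : int, inZg n (D%:R * (c *~ s)) -> (d%:Z %| s)%Z) ->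
  (forall w, inZg n ((D * d)%:R * w) -> exists s, inZg n (D%:R * (w - c *+ s))) ->
  (forall w, w \in [:: x; y1; y2; c *+ d] -> exists z : int, w = g *~ z) ->
  (forall z : int, B <= g *~ z -> Q (g *~ z)) ->
  0 < eps -> eps <= c -> eps <= x - c -> eps <= y1 - c -> eps <= y2 - x + c ->
  B <= eps *+ d ->
  exists Q' : rat -> Prop, [/\ cone n (D * d) u Q',
    forall w, inZg n (D%:R * w) -> (Q' w <-> Q w),
    Q' c /\ Q' (x - c) & Q' (y1 - c) /\ Q' (y2 - x + c)].
Proof.
move=> cQ Qx Qy1 Qy2 Qy hc cd cgen lat large eps0 ec exc ey1 ey2 Bd.
have [Q0 QD Qp [u0 Qu] Qk] := cQ.
pose comb q i j k l := q + (c *+ i + (y2 - x + c) *+ j) + ((x - c) *+ k + (y1 - c) *+ l).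
pose Q' w := exists q i j k l, Q q /\ w = comb q i j k l.
have [zx Ex] : exists z : int, x = g *~ z by apply: lat; rewrite !inE eqxx.
have [z1 E1] : exists z : int, y1 = g *~ z by apply: lat; rewrite !inE eqxx !orbT.
have [z2 E2] : exists z : int, y2 = g *~ z by apply: lat; rewrite !inE eqxx !orbT.
have [zc Ec] : exists z : int, c *+ d = g *~ z by apply: lat; rewrite !inE eqxx !orbT.
(* A sum of [d * m] terms, each at least [eps], reaches [B] as soon as [m] is positive. *)
have big v m : (0 < m)%N -> (exists z : int, v = g *~ z) -> eps *+ (d * m) <= v -> Q v.
  move=> m0 [z ->] hv; apply: large; apply: le_trans hv; apply: le_trans Bd _.
  by rewrite ler_pMn2l // leq_pmulr.
have lay v : Q v -> inZg n (D%:R * v) by case/Qp.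
(* Modulo the old layer both generators are congruent to [c], so [d] divides [i + j]. *)
have sideA i j q : Q q -> inZg n (D%:R * comb q i j 0 0) -> Q (comb q i j 0 0).
  move=> Qq hw; have /dvdnP[m Em] : (d %| i + j)%N.
    apply: (cd (i + j)%N); rewrite -pmulrn.
    have -> : c *+ (i + j) = comb q i j 0 0 - q - (y2 - x) *+ j.
      by rewrite /comb !mulr0n mulrnDr mulrnDl; ring.
    rewrite !mulrBr mulrnAr mulrBr.
    by apply: inZgB; [apply: inZgB => //; exact: lay|apply: inZgMn; apply: inZgB; exact: lay].
  have [m0|m0] := posnP m.
    have [-> ->] : i = 0%N /\ j = 0%N by move: Em; rewrite m0 mul0n; lia.
    by rewrite /comb !mulr0n !addr0.
  rewrite /comb !mulr0n !addr0; apply: QD => //; apply: (big _ m) => //.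
    exists (zc * m + (z2 - zx) * j).
    rewrite mulrnDl addrCA -mulrnDr Em mulnC mulrnA Ec E2 Ex -mulrzBr !pmulrn -!mulrzA.
    by rewrite -mulrzDr addrC.
  rewrite mulnC -Em mulrnDr; apply: lerD; exact: ler_wMn2r.
(* Here both generators are congruent to [- c], so [d] divides [k + l]. *)
have sideB k l q : Q q -> inZg n (D%:R * comb q 0 0 k l) -> Q (comb q 0 0 k l).
  move=> Qq hw; have /dvdnP[m Em] : (d %| k + l)%N.
    apply: (cd (k + l)%N); rewrite -pmulrn.
    have -> : c *+ (k + l) = q + (x *+ k + y1 *+ l) - comb q 0 0 k l.
      by rewrite /comb !mulr0n mulrnDr !mulrnBl; ring.
    rewrite mulrBr; apply: (inZgB _ hw); rewrite !mulrDr !mulrnAr.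
    by apply: inZgD; [|apply: inZgD; apply: inZgMn]; exact: lay.
  have [m0|m0] := posnP m.
    have [-> ->] : k = 0%N /\ l = 0%N by move: Em; rewrite m0 mul0n; lia.
    by rewrite /comb !mulr0n !addr0.
  rewrite /comb !mulr0n !addr0; apply: QD => //; apply: (big _ m) => //.
    exists (zx * k + z1 * l - zc * m).
    rewrite !mulrnBl addrACA -opprD -mulrnDr Em [(m * d)%N]mulnC mulrnA Ec E1 Ex !pmulrn -!mulrzA.
    by rewrite mulrzBr mulrzDr.
  rewrite mulnC -Em mulrnDr; apply: lerD; exact: ler_wMn2r.
(* Induction on the number of generators: a pair from opposite sides sums to [x], [y1], [y2] or
   [y1 + y2 - x] and is absorbed into [q], until only one side is left. *)
have back m : forall i j k l q, (i + j + k + l < m)%N -> Q q ->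
    inZg n (D%:R * comb q i j k l) -> Q (comb q i j k l).
  elim: m => [|m IH] i j k l q; first by rewrite ltn0.
  move=> lem Qq; have step i' j' k' l' v : Q v -> (i' + j' + k' + l' < m)%N ->
      comb q i j k l = comb (q + v) i' j' k' l' ->
      inZg n (D%:R * comb q i j k l) -> Q (comb q i j k l).
    by move=> Qv lem' -> ; apply: IH => //; exact: QD.
  case: i k lem step => [|i] [|k] lem step.
  - case: j lem step => [|j] lem step; first exact: sideB.
    case: l lem step => [|l] lem step; first exact: sideA.
    by apply: (step 0%N j 0%N l _ Qy); [lia|rewrite /comb !mulrS; ring].
  - case: j lem step => [|j] lem step; first exact: sideB.
    by apply: (step 0%N j k l _ Qy2); [lia|rewrite /comb !mulrS; ring].
  - case: l lem step => [|l] lem step; first exact: sideA.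
    by apply: (step i j 0%N l _ Qy1); [lia|rewrite /comb !mulrS; ring].
  - by apply: (step i j k l _ Qx); [lia|rewrite /comb !mulrS; ring].
exists Q'; split.
- split; rewrite /Q'.
  + by exists 0, 0%N, 0%N, 0%N, 0%N; rewrite /comb !mulr0n !addr0.
  + move=> v w [q [i [j [k [l [Qq ->]]]]]] [q' [i' [j' [k' [l' [Qq' ->]]]]]].
    exists (q + q'), (i + i')%N, (j + j')%N, (k + k')%N, (l + l')%N.
    by split; [exact: QD|rewrite /comb !mulrnDr; ring].
  + have emb v : inZg n (D%:R * v) -> inZg n ((D * d)%:R * v).
      by move=> hv; rewrite natrM mulrAC mulrC mulr_natl; exact: inZgMn.
    have lay' v : Q v -> inZg n ((D * d)%:R * v) by move=> /lay/emb.
    move=> w [q [i [j [k [l [Qq ->]]]]]]; split.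
      have [q0 _] := Qp _ Qq; rewrite /comb !addr_ge0 // mulrn_wge0 //; exact: le_trans (ltW eps0) _.
    rewrite /comb !mulrDr !mulrnAr !mulrDr !mulrN.
    by repeat first [exact: lay' | exact: hc | apply: inZgB | apply: inZgD | apply: inZgMn].
  + by split=> //; exists u, 0%N, 0%N, 0%N, 0%N; rewrite /comb !mulr0n !addr0.
  (* Subtracting a multiple of [c] returns to the old layer, where [u] absorbs; the multiple is then
     restored. *)
  + move=> w /cgen[s /Qk[k hk]]; exists k, (w - c *+ s + u *+ k), s, 0%N, 0%N, 0%N.
    by split=> //; rewrite /comb !mulr0n !addr0; ring.
- move=> w hw; split=> [[q [i [j [k [l [Qq E]]]]]]|Qw].
    by move: hw; rewrite E => hw; exact: (back (i + j + k + l).+1).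
  by exists w, 0%N, 0%N, 0%N, 0%N; rewrite /comb !mulr0n !addr0.
- split; [exists 0, 1%N, 0%N, 0%N, 0%N|exists 0, 0%N, 0%N, 1%N, 0%N].
    by rewrite /comb; split=> //; rewrite ?mulr0n ?mulr1n; ring.
  by rewrite /comb; split=> //; rewrite ?mulr0n ?mulr1n; ring.
- split; [exists 0, 0%N, 0%N, 0%N, 1%N|exists 0, 0%N, 1%N, 0%N, 0%N].
    by rewrite /comb; split=> //; rewrite ?mulr0n ?mulr1n; ring.
  by rewrite /comb; split=> //; rewrite ?mulr0n ?mulr1n; ring.
Qed.

(** The Bézout coefficient [U] inverts [k] modulo [d], and [s] is the residue of [a * U]. It is a
    natural number because cones are closed only under natural multiples. *)
Lemma mod_inverse (a : int) (k d : nat) : (0 < d)%N -> coprime k d ->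
  exists s : nat, (d%:Z %| a - s%:Z * k%:Z)%Z.
Proof.
move=> d0 cop; have : coprimez k d by [].
move=> /coprimezP[[U V] /= UV].
exists `|(a * U %% d)%Z|%N.
have -> : `|(a * U %% d)%Z|%:Z = (a * U %% d)%Z.
  by rewrite gez0_abs // modz_ge0 //; lia.
have E := divz_eq (a * U) d.
apply/dvdzP; exists (a * V + (a * U %/ d)%Z * k).
have -> : (a * U %% d)%Z = a * U - (a * U %/ d)%Z * d by lia.
have : a = a * (U * k + V * d) by rewrite UV mulr1.
by move=> Ea; rewrite {1}Ea; ring.
Qed.

(** Strict positivity leaves room between [max(0, x - y2)] and [min(x, y1)]; there [c] is placed as
    [t / (D * d)] with [t] coprime to [d]. *)
Lemma cone_extend_pos n m N u Q x y1 y2 : gint_infinite m -> gcoprime n m ->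
  cone n (lcm_upto m N) u Q -> Q x -> Q y1 -> Q y2 -> Q (y1 + y2 - x) ->
  0 < x -> 0 < y1 -> 0 < y2 -> 0 < y1 + y2 - x ->
  exists N' (Q' : rat -> Prop) c, [/\ (N < N')%N, cone n (lcm_upto m N') u Q',
    forall w, inZg n ((lcm_upto m N)%:R * w) -> (Q' w <-> Q w),
    Q' c /\ Q' (x - c) & Q' (y1 - c) /\ Q' (y2 - x + c)].
Proof.
move=> infm nm cQ Qx Qy1 Qy2 Qy x0 y10 y20 y0.
have [Q0 QD Qp [u0 Qu] Qk] := cQ.
have [D0 Dm] := lcm_upto_gdvd m N.
set D := lcm_upto m N in cQ Qp Qk D0 Dm *.
have Dp : 0 < D%:R :> rat by rewrite ltr0n.
have Dn : D%:R != 0 :> rat by rewrite gt_eqF.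
(* [D^-1] is included so that [c *+ d], which equals [t / D], will lie in the lattice although [t]
   is chosen later. *)
have [w|g [g0 hg lat]] := @cyclic_lattice n D [:: x; y1; y2; D%:R^-1] D0.
  rewrite !inE => /or4P[] /eqP->; try by case: (Qp _ Qx); case: (Qp _ Qy1); case: (Qp _ Qy2).
  by rewrite divff //; exact: inZg_int 1.
have [B hB] := cone_large cQ g0 hg.
have [lo [hi [lohi [lo0 lo2] [hi1 hi2]]]] : exists lo hi : rat,
    [/\ lo < hi, 0 <= lo /\ x - y2 <= lo & hi <= x /\ hi <= y1].
  exists (Num.max 0 (x - y2)), (Num.min x y1); rewrite gt_max !lt_min x0 y10 /=.
  rewrite !le_max !ge_min !lexx !orbT; split=> //; apply/andP; split; lra.
(* [c] will lie between [lo + eps] and [lo + 2 eps], hence at least [eps] away from both ends. *)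
have [eps eps0 epsE] : exists2 eps : rat, 0 < eps & eps * 3 = hi - lo.
  by exists ((hi - lo) / 3); [rewrite divr_gt0 // subr_gt0|rewrite divfK].
(* The first bound fits the window of numerators into length [eps]; the second makes [eps *+ d]
   reach [B]. *)
pose Bn := (Num.truncn (Num.max (3 / (D%:R * eps)) (B / eps))).+1.
have Bn1 : 3 / (D%:R * eps) < Bn%:R /\ B / eps < Bn%:R.
  by apply/andP; rewrite -gt_max truncnS_gt.
have [N' [d1 [q [e [NN' E pq qd1 Be]]]]] := lcm_upto_jump N Bn infm.
have [D'0 D'm] := lcm_upto_gdvd m N'.
rewrite -/D in E; rewrite E in D'0 D'm.
have [d dE] : exists d, d = (d1 * q ^ e)%N by exists (d1 * q ^ e)%N.
rewrite -dE in E D'0 D'm.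
have d0 : (0 < d)%N by case: (d) D'0; rewrite ?muln0.
have d10 : (0 < d1)%N by move: d0; rewrite dE muln_gt0 => /andP[].
have dm : gdvd (gint_of_nat d) m.
  by apply: gdvd_dvdn D'0 _ D'm; rewrite dvdn_mull.
have D'p : 0 < (D * d)%:R :> rat by rewrite ltr0n.
have D'n : (D * d)%:R != 0 :> rat by rewrite gt_eqF.
have dp : 0 < d%:R :> rat by rewrite ltr0n.
have dn : d%:R != 0 :> rat by rewrite gt_eqF.
have [|t [ct t1 t2]] := @coprime_in_interval ((D * d)%:R * (lo + eps)) d1 q e _ d10 pq qd1.
  by rewrite mulr_ge0 ?addr_ge0 // ltW.
rewrite -dE in ct.
have Be' : Bn%:R <= (q ^ e)%:R :> rat by rewrite ler_nat.
have d11 : 1 <= d1%:R :> rat by rewrite ler1n.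
have small : 3 * d1%:R <= (D * d)%:R * eps.
  have [+ _] := Bn1; rewrite ltr_pdivrMr ?mulr_gt0 // => h.
  have h3 : 3 <= (q ^ e)%:R * (D%:R * eps).
    by apply: le_trans (ltW h) _; rewrite ler_pM2r // mulr_gt0.
  apply: le_trans (_ : (q ^ e)%:R * (D%:R * eps) * d1%:R <= _).
    by rewrite ler_pM2r // ltr0n.
  by rewrite dE !natrM le_eqVlt; apply/orP; left; apply/eqP; ring.
pose c : rat := t%:R / (D * d)%:R.
have c1 : lo + eps < c by rewrite /c ltr_pdivlMr // mulrC.
have c2 : c <= lo + eps + eps.
  by rewrite /c ler_pdivrMr // [X in _ <= X]mulrC mulrDr; lra.
have chi : c <= hi - eps by lra.
have [|||||||||||Q' [cQ' ext q1 q2]] :=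
  @adjoin_riesz n D d u Q x y1 y2 c g B eps cQ Qx Qy1 Qy2 Qy.
- rewrite /c mulrCA divff // mulr1; exact: inZg_int t.
- move=> s; have -> : D%:R * (c *~ s) = (t%:Z * s)%:~R / d%:R.
    by rewrite /c -mulrzr intrM -pmulrn natrM; field; rewrite Dn dn.
  move=> /(inZg_frac nm d0 dm); rewrite Gauss_dvdzr //.
  by rewrite coprimezE /= coprime_sym.
(* Here [w] is [a / (D * d * b)], so [w - c *+ s] falls into the old layer once [s * t * b] is
   congruent to [a] modulo [d]; both [t] and [b] are coprime to [d]. *)
- move=> w [a [b [b0 bn Ew]]].
  have cop : coprime (t * b) d by rewrite coprimeMl ct (gcoprime_coprime nm b0 d0 bn dm).
  have [s /dvdzP[z Ez]] := mod_inverse a d0 cop.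
  exists s, z, b; split=> //.
  have bn0 : b%:R != 0 :> rat by rewrite pnatr_eq0 -lt0n.
  apply: (mulfI dn); have -> : d%:R * (D%:R * (w - c *+ s)) = (D * d)%:R * w - t%:R * s%:R.
    by rewrite /c -[_ *+ s]mulr_natr !natrM; field; rewrite Dn dn.
  rewrite Ew; have : a%:~R - s%:R * (t%:R * b%:R) = z%:~R * d%:R :> rat.
    by rewrite -[d%:R]/(d%:Z%:~R) -intrM -Ez intrB intrM -!pmulrn natrM.
  move=> h; have -> : a%:~R = z%:~R * d%:R + s%:R * (t%:R * b%:R) :> rat by rewrite -h subrK.
  by field.
- have [z Ez] : exists z : int, D%:R^-1 = g *~ z by apply: lat; rewrite !inE eqxx !orbT.
  move=> w; rewrite !inE => /or4P[] /eqP->; try by apply: lat; rewrite !inE eqxx ?orbT.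
  exists (z * t%:Z); rewrite mulrzA -Ez /c -mulrzr -pmulrn -mulr_natr natrM; field.
  by rewrite Dn dn.
- exact: hB.
- exact: eps0.
- lra.
- lra.
- lra.
- lra.
- have [_] := Bn1; rewrite ltr_pdivrMr // -[eps *+ d]mulr_natl => h.
  apply: le_trans (ltW h) _; rewrite ler_pM2r //.
  apply: le_trans Be' _; rewrite ler_nat dE leq_pmull //.
- by exists N', Q', c; rewrite E.
Qed.

(** If one of the four elements vanishes, a solution is already in the old cone: [c] is [0] when [x]
    or [y1] vanishes, [x] when [y2] does, and [y1] when [y1 + y2 - x] does. *)
Lemma cone_extend n m N u Q x y1 y2 : gint_infinite m -> gcoprime n m ->
  cone n (lcm_upto m N) u Q ->
  exists N' (Q' : rat -> Prop), [/\ (N < N')%N, cone n (lcm_upto m N') u Q',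
    forall w, inZg n ((lcm_upto m N)%:R * w) -> (Q' w <-> Q w)
  & Q x -> Q y1 -> Q y2 -> Q (y1 + y2 - x) ->
    exists c, [/\ Q' c, Q' (x - c), Q' (y1 - c) & Q' (y2 - x + c)]].
Proof.
move=> infm nm cQ; have [Q0 QD Qp [u0 Qu] Qk] := cQ.
have [[[Qx Qy1 Qy2 Qy] [x0 y10 y20 y0]]|deg] := pselect
    ([/\ Q x, Q y1, Q y2 & Q (y1 + y2 - x)] /\ [/\ 0 < x, 0 < y1, 0 < y2 & 0 < y1 + y2 - x]).
  have [N' [Q' [c [NN' cQ' ext [h1 h2] [h3 h4]]]]] :=
    cone_extend_pos infm nm cQ Qx Qy1 Qy2 Qy x0 y10 y20 y0.
  by exists N', Q'; split=> // _ _ _ _; exists c.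
(* The layer must advance in every case, so the always nondegenerate triple [u, u, u] is used
   instead. *)
have Quuu : Q (u + u - u) by rewrite addrK.
have uuu0 : 0 < u + u - u by rewrite addrK.
have [N' [Q' [_ [NN' cQ' ext _ _]]]] := cone_extend_pos infm nm cQ Qu Qu Qu Quuu u0 u0 u0 uuu0.
exists N', Q'; split=> // Qx Qy1 Qy2 Qy.
have up v : Q v -> Q' v by move=> Qv; apply/ext => //; case: (Qp _ Qv).
have [xp _] := Qp _ Qx; have [y1p _] := Qp _ Qy1; have [y2p _] := Qp _ Qy2.
have [yp _] := Qp _ Qy.
move: xp y1p y2p yp; rewrite !le_eqVlt.
move=> /predU1P[x0|x0].
  by exists 0; rewrite -x0 !subr0 ?addr0; split; apply: up.
move=> /predU1P[y10|y10].
  by exists 0; rewrite -y10 !subr0 ?addr0; split; apply: up => //; rewrite -[y2]add0r y10.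
move=> /predU1P[y20|y20].
  exists x; rewrite subrr -y20 sub0r addNr; split; apply: up => //.
  by move: Qy; rewrite -y20 addr0.
move=> /predU1P[y0|y0]; last by case: deg.
have Ex : x = y1 + y2 by lra.
exists y1; rewrite Ex subrr addrAC subrr add0r opprD addrCA subrr addr0 addNr.
by split; apply: up.
Qed.

(** * Union of the layers *)

(** The last clause encodes the Riesz splitting [x = c + (x - c)]. No stage changes the cone on
    earlier layers, so the union keeps [P0] as its trace on [Z_n]. *)
Lemma riesz_cone n m u P0 : gint_infinite m -> gcoprime n m -> cone n 1 u P0 ->
  exists Q, [/\ cone (gmul n m) 1 u Q, forall w, inZg n w -> (Q w <-> P0 w)
    & forall x y1 y2, Q x -> Q y1 -> Q y2 -> Q (y1 + y2 - x) ->
      exists c, [/\ Q c, Q (x - c), Q (y1 - c) & Q (y2 - x + c)]].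
Proof.
move=> infm nm cP.
pose good (s : nat * (rat -> Prop)) := cone n (lcm_upto m s.1) u s.2.
pose lay N w := inZg n ((lcm_upto m N)%:R * w).
(* The 2-adic valuation takes each value infinitely often, so every triple is
   treated at a stage at which its entries are already available. *)
pose task k : rat * rat * rat := odflt (0, 0, 0) (unpickle (logn 2 k)).
pose next k (s s' : nat * (rat -> Prop)) := [/\ (s.1 < s'.1)%N, good s',
  forall w, lay s.1 w -> (s'.2 w <-> s.2 w)
  & let: (x, y1, y2) := task k in s.2 x -> s.2 y1 -> s.2 y2 -> s.2 (y1 + y2 - x) ->
    exists c, [/\ s'.2 c, s'.2 (x - c), s'.2 (y1 - c) & s'.2 (y2 - x + c)]].
(* Keeping [good] as a premise under the existential makes the step function total. *)
have /choice[F hF] : forall ks : nat * (nat * (rat -> Prop)),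
    exists s', good ks.2 -> next ks.1 ks.2 s'.
  move=> [k [N Q]]; have [gs|ngs] := pselect (good (N, Q)); last by exists (N, Q).
  case E: (task k) => [[x y1] y2].
  have [N' [Q' [NN' gs' ext sol]]] := cone_extend x y1 y2 infm nm gs.
  by exists (N', Q') => _; rewrite /next E.
pose st := fix st k := if k is k'.+1 then F (k', st k') else (0%N, P0).
have gst k : good (st k).
  elim: k => [|k IH]; first by rewrite /good /= lcm_upto0.
  by case: (hF (k, st k) IH).
have nst k : next k (st k) (st k.+1) := hF (k, st k) (gst k).
have lay_mono N N' w : (N <= N')%N -> lay N w -> lay N' w.
  move=> /(lcm_upto_dvdn m) /dvdnP[j Ej] hw; rewrite /lay Ej natrM -mulrA mulr_natl.
  exact: inZgMn.
have st1_mono k j : ((st k).1 + j <= (st (k + j)%N).1)%N.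
  elim: j => [|j IH]; first by rewrite !addn0.
  by rewrite !addnS; case: (nst (k + j)%N) => + _ _ _; apply: leq_ltn_trans.
have ext k j w : lay (st k).1 w -> ((st (k + j)%N).2 w <-> (st k).2 w).
  move=> hw; elim: j => [|j IH]; first by rewrite addn0.
  rewrite -IH addnS; case: (nst (k + j)%N) => _ _ + _; apply.
  by apply: lay_mono hw; have := st1_mono k j; lia.
pose Q w := exists k, (st k).2 w.
have up k l w : (k <= l)%N -> (st k).2 w -> (st l).2 w.
  move=> kl Qw; rewrite -(subnKC kl); apply/ext => //.
  by have [_ _ /(_ _ Qw)[]] := gst k.
(* The layer number grows strictly, so stage [N] is at or beyond layer [N]. *)
have layE w : inZg (gmul n m) w <-> exists k, lay (st k).1 w.
  rewrite inZg_gmul //; split=> [[N hN]|[k hk]]; last by exists (st k).1.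
  by exists N; apply: lay_mono hN; have := st1_mono 0%N N; rewrite add0n; lia.
exists Q; split.
- split.
  + by exists 0%N; case: cP.
  + move=> x y [k hx] [l hy]; exists (maxn k l); have [_ QD _ _ _] := gst (maxn k l).
    by apply: QD; [apply: up hx|apply: up hy]; lia.
  + move=> x [k hx]; have [_ _ /(_ _ hx)[x0 lx] _ _] := gst k.
    by split=> //; rewrite mul1r; apply/layE; exists k.
  + by have [_ _ _ [u0 Pu] _] := cP; split=> //; exists 0%N.
  + move=> x; rewrite mul1r => /layE[k hx]; have [_ _ _ _ /(_ _ hx)[i hi]] := gst k.
    by exists i, k.
- move=> w hw; have hw0 : lay (st 0%N).1 w by rewrite /lay /= lcm_upto0 mul1r.
  split=> [[k hk]|h]; last by exists 0%N.
  by rewrite -[k]add0n in hk; move: hk => /(ext _ _ _ hw0).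
- move=> x y1 y2 [k1 h1] [k2 h2] [k3 h3] [k4 h4].
  pose K := (k1 + k2 + k3 + k4)%N.
  (* The 2-adic valuation of [k] codes the triple, while [3 ^ K] pushes [k] past the stages where
     the four elements enter. *)
  pose k := (2 ^ pickle (x, y1, y2) * 3 ^ K)%N.
  have Kk : (K <= k)%N.
    apply: leq_trans (ltnW (ltn_expl K (isT : 1 < 3)%N)) _.
    by rewrite /k leq_pmull // expn_gt0.
  have Tk : task k = (x, y1, y2).
    rewrite /task /k lognM ?expn_gt0 // pfactorK // lognX.
    by rewrite (_ : logn 2 3 = 0)%N // muln0 addn0 pickleK.
  have [_ _ _] := nst k; rewrite Tk => /(_ _ _ _ _)[].
  + by apply: up h1; lia.
  + by apply: up h2; lia.
  + by apply: up h3; lia.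
  + by apply: up h4; lia.
  + by move=> c [c1 c2 c3 c4]; exists c; split; exists k.+1.
Qed.

(** * Transport from cones of rationals to abstract groups *)

Definition Zg_pred (n : gint) : {pred rat} := fun q => `[< inZg n q >].

Lemma Zg_zmod_closed n : zmod_closed (Zg_pred n).
Proof.
split=> [|x y]; first by apply/asboolP; exact: (inZg_int n 0).
by move=> /asboolP hx /asboolP hy; apply/asboolP; exact: inZgB.
Qed.

HB.instance Definition _ n := GRing.isZmodClosed.Build rat (Zg_pred n) (Zg_zmod_closed n).

Definition Zg (n : gint) := {q : rat | q \in Zg_pred n}.
HB.instance Definition _ n := SubChoice.on (Zg n).
HB.instance Definition _ n := [SubChoice_isSubZmodule of Zg n by <:].

Lemma additive_map0 (G H : zmodType) (f : G -> H) : additive_map f -> f 0 = 0.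
Proof. by move=> fD; apply: (addrI (f 0)); rewrite -fD !addr0. Qed.

Lemma additive_mapN (G H : zmodType) (f : G -> H) x : additive_map f -> f (- x) = - f x.
Proof. by move=> fD; apply: (addrI (f x)); rewrite -fD !subrr additive_map0. Qed.

Lemma additive_mapMn (G H : zmodType) (f : G -> H) x k : additive_map f ->
  f (x *+ k) = f x *+ k.
Proof.
move=> fD; elim: k => [|k IH]; first by rewrite additive_map0.
by rewrite !mulrS fD IH.
Qed.

(** Stated for an arbitrary [Q] because it serves both the zero cone and the constructed one.
    Nonnegativity supplies antisymmetry. *)
Lemma order_embedding_into_Zg (G : zmodType) (P : G -> Prop) (n m : gint) (f : G -> rat) (Q : rat -> Prop) :
  (exists x : G, x <> 0) -> additive_map f -> injective f ->
  (forall x, inZg (gmul n m) (f x)) ->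
  (forall x, Q (f x) <-> P x) ->
  Q 0 -> (forall x y, Q x -> Q y -> Q (x + y)) ->
  (forall x, Q x -> 0 <= x /\ inZg (gmul n m) x) ->
  (forall u x, Q u -> u != 0 -> inZg (gmul n m) x -> exists k, Q (x + u *+ k)) ->
  (forall x y1 y2, Q x -> Q y1 -> Q y2 -> Q (y1 + y2 - x) ->
      exists c, [/\ Q c, Q (x - c), Q (y1 - c) & Q (y2 - x + c)]) ->
  exists (H : zmodType) (Q : H -> Prop) (tau : G -> H),
    (pogroup Q /\ simple_po Q /\ riesz Q /\ rank_one H) /\
    positive_morphism P Q tau /\
    iso_Zg H (gmul n m) /\ order_embedding P Q tau.
Proof.
move=> [z z0] fD finj fZ fQ Q0 QD Qp Qk Qr.
pose H : zmodType := Zg (gmul n m).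
have mk q : inZg (gmul n m) q -> {h : H | val h = q}.
  by move=> hq; exists (exist _ q (introT (asboolP _) hq)).
pose tau x : H := sval (mk _ (fZ x)).
have vtau x : val (tau x) = f x by exact: (svalP (mk _ (fZ x))).
pose QH (h : H) := Q (val h).
have H0 : exists h : H, h <> 0.
  exists (tau z) => /(congr1 val); rewrite vtau raddf0 => fz; apply: z0.
  by apply: finj; rewrite fz additive_map0.
have pm : positive_morphism P QH tau.
  split=> [x y|x Px]; last by rewrite /QH vtau; apply/fQ.
  by apply: val_inj; rewrite raddfD /= !vtau fD.
have valZ (h : H) : inZg (gmul n m) (val h) by case: h => q hq; exact/asboolP.
exists H, QH, tau; split; [split; [|split; [|split]]|split; [|split]] => //.
- split; rewrite /QH.
  + by rewrite raddf0.
  + by move=> x y; rewrite raddfD; exact: QD.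
  + move=> x /Qp[x0 _] /Qp[]; rewrite raddfN oppr_ge0 => x0' _.
    by apply: val_inj; rewrite raddf0; apply/eqP; rewrite eq_le x0 x0'.
- split=> // u Qu u0.
  have u0' : val u != 0.
    by apply/eqP => E; apply: u0; apply: val_inj; rewrite E raddf0.
  have QM k : Q (val u *+ k) by elim: k => [|k IH] //; rewrite mulrS; exact: QD.
  (* Absorbing [x] and [- x] separately and adding the two multiples gives both bounds of an
     order-unit. *)
  move=> x; have [k hk] := Qk _ _ Qu u0' (valZ x).
  have [l hl] := Qk _ _ Qu u0' (valZ (- x)).
  exists (k + l)%N; rewrite /pole /QH; split.
    by rewrite opprK raddfD raddfMn mulrnDr addrA; exact: QD.
  by rewrite raddfB raddfMn mulrnDr -addrA [X in _ + X]addrC; exact: QD.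
- move=> x y1 y2 Qx Qy1 Qy2; rewrite /pole /QH raddfB raddfD => Qy.
  have [c [c1 c2 c3 c4]] := Qr _ _ _ Qx Qy1 Qy2 Qy.
  have [hc E] := mk c (Qp _ c1).2; rewrite -E in c1 c2 c3 c4.
  exists hc, (x - hc); split; rewrite ?[_ + (x - hc)]addrC ?subrK /QH /pole ?raddfB //.
  by rewrite /= opprK addrA.
- by split=> //; exists val; split; [move=> x y; rewrite raddfD|exact: val_inj].
- exists val; split; [by move=> x y; rewrite raddfD|exact: val_inj|].
  by move=> q; split=> [/mk[h <-]|[h <-]]; [exists h|].
- split=> //; first by move=> x y E; apply: finj; rewrite -!vtau E.
  move=> y; split=> [[x [Px <-]]|[[x <-] Qx]].
    by split; [exists x|case: pm => _; apply].
  by exists x; split=> //; apply/fQ; rewrite -vtau.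
Qed.

(** * Simplicity, the initial cone and the conclusion *)

(** Some positive multiple of [v] is a positive multiple of [u], so absorption passes from [u] to
    [v]. *)
Lemma cone_absorbs n u Q v x : cone n 1 u Q -> Q v -> v != 0 -> inZg n x ->
  exists k, Q (x + v *+ k).
Proof.
move=> cQ Qv vn0 hx; have [Q0 QD Qp [u0 Qu] Qk] := cQ.
have v0 : 0 < v by rewrite lt0r vn0; case: (Qp _ Qv).
have [a [b [a0 b0 ab]]] := pos_commensurable v0 u0.
have [|k hk] := Qk x; first by rewrite mul1r.
exists (a * k)%N; rewrite mulrnA ab -mulrnA -(subnKC (leq_pmull k b0)) mulrnDr addrA.
by apply: QD => //; exact: coneMn cQ Qu.
Qed.

(** No [x] in [P] has [f x < 0]: a positive multiple of [x] would be the opposite of a positive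
    multiple of [v], against antisymmetry. *)
Lemma image_cone (G : zmodType) (P : G -> Prop) (n : gint) (f : G -> rat) (v : G) :
  pogroup P -> simple_po P -> additive_map f -> injective f ->
  (forall q, inZg n q <-> exists x, f x = q) -> P v -> 0 < f v ->
  cone n 1 (f v) (fun q => exists2 x, P x & f x = q).
Proof.
move=> [P0 PD Panti] [_ Punit] fD finj fZ Pv fv0.
have PM x k : P x -> P (x *+ k).
  by move=> Px; elim: k => [|k IH] //; rewrite mulrS; exact: PD.
have v0 : v <> 0 by move=> v0; rewrite v0 additive_map0 // ltxx in fv0.
split.
- by exists 0; rewrite ?additive_map0.
- by move=> _ _ [x Px <-] [y Py <-]; exists (x + y); [exact: PD|exact: fD].
- move=> _ [x Px <-]; split; last by rewrite mul1r; apply/fZ; exists x.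
  rewrite leNgt; apply/negP => fx0.
  have fNx : 0 < - f x by rewrite oppr_gt0.
  have [a [b [a0 b0 ab]]] := pos_commensurable fv0 fNx.
  have E : - (v *+ a) = x *+ b.
    by apply: finj; rewrite (additive_mapN _ fD) !(additive_mapMn _ _ fD) ab mulNrn opprK.
  have /(congr1 f) : v *+ a = 0 by apply: Panti; rewrite ?E; exact: PM.
  rewrite (additive_mapMn _ _ fD) (additive_map0 fD) => /eqP.
  by rewrite mulrn_eq0 (gt_eqF fv0) orbF eqn0Ngt a0.
- by split=> //; exists v.
- move=> q; rewrite mul1r => /fZ[x <-]; have [k [hk _]] := Punit v Pv v0 x.
  exists k, (x + v *+ k); last by rewrite fD (additive_mapMn _ _ fD).
  by move: hk; rewrite /pole opprK.
Qed.

Theorem theorem1p2 (G : zmodType) (P : G -> Prop) (n : gint) :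
  pogroup P -> simple_po P -> rank_one G -> iso_Zg G n ->
  forall m : gint, gint_infinite m -> gcoprime n m ->
  exists (H : zmodType) (Q : H -> Prop) (tau : G -> H),
    (pogroup Q /\ simple_po Q /\ riesz Q /\ rank_one H) /\
    positive_morphism P Q tau /\
    iso_Zg H (gmul n m) /\ order_embedding P Q tau.
Proof.
move=> poP siP [nz _] [f [fD finj fZ]] m infm nm.
have Znm q : inZg n q -> inZg (gmul n m) q.
  by move=> hq; apply/inZg_gmul => //; exists 0%N; rewrite lcm_upto0 mul1r.
(* A zero cone has no order-unit to start from; the zero cone on the larger group then answers, its
   simplicity condition being vacuous. *)
have [[v [Pv v0]]|Ptriv] := pselect (exists v, P v /\ v <> 0); last first.
  have [P0 _ _] := poP.
  apply: (@order_embedding_into_Zg _ _ _ _ f (fun q => q = 0)) => //.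
  - by move=> x; apply: Znm; apply/fZ; exists x.
  - move=> x; split=> [fx|Px].
      by have -> : x = 0 by apply: finj; rewrite fx additive_map0.
    rewrite (_ : x = 0) ?additive_map0 //.
    by apply: contrapT => x0; apply: Ptriv; exists x.
  - by move=> x y -> ->; rewrite addr0.
  - by move=> x ->; split=> //; exact: (inZg_int _ 0).
  - by move=> u x ->; rewrite eqxx.
  - by move=> x y1 y2 -> -> -> _; exists 0; rewrite !subr0 ?addr0.
(* [- f] has the same image as [f], so the sign at [v] may be chosen. *)
wlog fv0 : f fD finj fZ / 0 < f v.
  move=> wl; have [|fv0|fv0] := ltgtP 0 (f v); first exact: wl.
    apply: (wl (fun x => - f x)).
    - by move=> x y; rewrite fD opprD.
    - by move=> x y /oppr_inj/finj.
    - move=> q; split=> [hq|[x <-]].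
        have /fZ[x Ex] : inZg n (- q) by rewrite -sub0r; exact: inZgB (inZg_int _ 0) hq.
        by exists x; rewrite Ex opprK.
      by rewrite -sub0r; apply: inZgB; [exact: (inZg_int _ 0)|apply/fZ; exists x].
    - by rewrite oppr_gt0.
  by case: v0; apply: finj; rewrite -fv0 additive_map0.
have cP := image_cone poP siP fD finj fZ Pv fv0.
have [Q [cQ QP Qr]] := riesz_cone infm nm cP.
have [Q0 QD Qp _ _] := cQ.
apply: (@order_embedding_into_Zg _ _ _ _ f Q) => //.
- by move=> x; apply: Znm; apply/fZ; exists x.
- move=> x; rewrite QP; last by apply/fZ; exists x.
  by split=> [[y Py /finj <-]|Px]; [|exists x].
- by move=> x /Qp; rewrite mul1r.
- by move=> w x Qw w0; exact: cone_absorbs cQ Qw w0.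
Qed.
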